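(* Let $1 \le k < n$ be integers. The order polytope $\mathcal{O}(Q_{k,n})$ of the Grassmannian poset is unimodular equivalent to the matching field polytope $P_{\mathcal{D}}$ of the diagonal matching field $\mathcal{D}=\mathcal{D}(k,n)$. Moreover, the unimodular map between them may be chosen so that, for every filter $F \subseteq Q_{k,n}$, the vertex $\chi_F \in \mathcal{O}(Q_{k,n})$ is mapped to the vertex $v_{\mathcal{D}, J(F)} \in P_{\mathcal{D}}$.
   Context: Write $[n]=\{1,\dots,n\}$. Poset. $Q_{k,n} = \{(i,j)\in\mathbb{Z}^2 : 1\le i\le k,\ 1 \le j \le n-k\}$ is the poset with $(a,b) \le (c,d)$ iff $a \le c$ and $b \le d$. For a finite poset $\Pi=\{p_1,\dots,p_d\}$ the order polytope is $\mathcal{O}(\Pi)=\{x\in\mathbb{R}^d : x_i\le x_j \text{ if } p_i<p_j,\ 0\le x_i\le 1 \text{ for all } i\}$. A filter of $\Pi$ is a subset $F \subseteq \Pi$ such that $p\in F$, $q \in \Pi$, $p<q$ imply $q\in F$ (the empty set is a filter). The vertices of $\mathcal{O}(\Pi)$ are exactly the characteristic vectors $\chi_F$ of filters $F$, where $(\chi_F)_i = 1$ if $p_i\in F$ and $0$ otherwise. For a filter $F\subseteq Q_{k,n}$ and $i\in[k]$, let $s_F(i) = |\{(i,j)\in F : j\in[n-k]\}|$ and $J(F) = \{i+s_F(i) : i\in[k]\}\subseteq[n]$. Matching field polytope. The diagonal matching field $\mathcal{D}(k,n)$ has as its tuples all $(i_1,\dots,i_k)$ with $1\le i_1<\dots<i_k\le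 n$. With $e_{i,j}$ the standard basis of $\mathbb{R}^{k\times n}$, for $J=\{j_1<\dots<j_k\}\subseteq[n]$ put $v_{\mathcal{D},J} = \sum_{i=1}^k e_{i,j_i}$, and $P_{\mathcal{D}} = \mathrm{Conv}\{v_{\mathcal{D},J} : J\subseteq[n],\ |J|=k\}\subseteq\mathbb{R}^{k\times n}$; the $v_{\mathcal{D},J}$ are its vertices. Two lattice polytopes $P,Q$ are unimodular equivalent if there is an affine isomorphism (a unimodular map) between their affine spans that maps $P$ onto $Q$ and restricts to a bijection between their distinguished lattices, the distinguished lattice of a polytope being the $\mathbb{Z}$-affine span of its vertices. *)

(* Defs.v *)
From HB Require Import structures.
From mathcomp Require Import all_boot all_order all_algebra.
From mathcomp Require Import all_classical all_reals.

Set Implicit Arguments.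
Unset Strict Implicit.
Unset Printing Implicit Defensive.

Import Order.TTheory GRing.Theory Num.Theory.

Local Open Scope classical_set_scope.
Local Open Scope ring_scope.

Section Polytopes.
Context {R : realType}.

(* Finite combinations of points of A whose coefficients lie in C and sum
   to 1.  The coefficient set C selects the kind of span. *)
Definition combinations (V : lmodType R) (C : set R) (A : set V) : set V :=
  [set x | exists (m : nat) (c : 'I_m -> R) (a : 'I_m -> V),
    [/\ forall i, C (c i), forall i, A (a i), \sum_(i < m) c i = 1
      & x = \sum_(i < m) c i *: a i]].

Definition affine_span (V : lmodType R) (A : set V) : set V :=
  combinations setT A.

Definition convex_hull (V : lmodType R) (A : set V) : set V :=
  combinations [set c | 0 <= c] A.

Definition int_affine_span (V : lmodType R) (A : set V) : set V :=
  combinations [set c | c \is a Num.int] A.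

(* Vertices as extreme points. *)
Definition vertices (V : lmodType R) (P : set V) : set V :=
  [set x | P x /\ forall (y z : V) (t : R), P y -> P z -> 0 < t < 1 ->
    x = t *: y + (1 - t) *: z -> y = x /\ z = x].

Definition polytope_lattice (V : lmodType R) (P : set V) : set V :=
  int_affine_span (vertices P).

Definition affine_on (V W : lmodType R) (A : set V) (f : V -> W) : Prop :=
  forall (x y : V) (t : R), A x -> A y ->
    f (t *: x + (1 - t) *: y) = t *: f x + (1 - t) *: f y.

(* A map between the affine spans is represented by a function on the ambient
   space, of which only the values on [affine_span P] matter. *)
Definition unimodular_map (V W : lmodType R) (P : set V) (Q : set W)
    (f : V -> W) : Prop :=
  [/\ affine_on (affine_span P) f,
      set_bij (affine_span P) (affine_span Q) f,
      f @` P = Q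
    & set_bij (polytope_lattice P) (polytope_lattice Q) f].

Definition unimodular_equivalent (V W : lmodType R) (P : set V) (Q : set W)
    : Prop :=
  exists f : V -> W, unimodular_map P Q f.

End Polytopes.

Section Posets.
Context {disp : Order.disp_t} {T : finPOrderType disp}.

(* R^o is R as a module over itself, which makes {ffun T -> R^o} the R-module
   of real vectors with coordinates indexed by T. *)
Definition order_polytope (R : realType) : set {ffun T -> R^o} :=
  [set x : {ffun T -> R^o} | (forall p q : T, (p < q)%O -> (x p : R) <= x q) /\
           (forall p : T, 0 <= (x p : R) <= 1)].

Definition is_poset_filter (F : {set T}) : Prop :=
  forall p q : T, p \in F -> (p < q)%O -> q \in F.

Definition char_vector (R : realType) (F : {set T}) : {ffun T -> R^o} :=
  [ffun p => (p \in F)%:R].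

End Posets.

Arguments order_polytope {disp} T R.

(* The componentwise order on pairs.  All indices start from 0: the element
   (i, j) here stands for (i + 1, j + 1) in [k] x [n - k], and likewise j in
   'I_n stands for j + 1 in [n]. *)
Definition grassmann_poset (k n : nat) : finPOrderType _ :=
  ('I_k *p 'I_(n - k))%type.

Section GrassmannPoset.
Context {k n : nat}.
Implicit Types F : {set grassmann_poset k n}.

Definition row_count F (i : 'I_k) : nat := #|[set p in F | p.1 == i]|.

(* With indices starting from 0, the shift on i and the one on [n] cancel. *)
Definition subset_of_filter F : {set 'I_n} :=
  [set j : 'I_n | [exists i : 'I_k, (j == i + row_count F i :> nat)%N]].

End GrassmannPoset.

Section MatchingFields.
Context {k n : nat}.

(* For every k-subset J of 'I_n, a matching field L has exactly one tuple with
   set of entries J; the value 0 is only taken when L has no such tuple. *)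
Definition mf_vertex (R : realType) (L : {set k.-tuple 'I_n})
    (J : {set 'I_n}) : 'M[R]_(k, n) :=
  if [pick t in L | [set j in t] == J] is Some t
  then \sum_(i < k) delta_mx i (tnth t i) else 0.

Definition mf_polytope (R : realType) (L : {set k.-tuple 'I_n})
    : set 'M[R]_(k, n) :=
  convex_hull [set v | exists2 J : {set 'I_n}, #|J| = k & v = mf_vertex R L J].

End MatchingFields.

Arguments mf_vertex {k n} R L J.
Arguments mf_polytope {k n} R L.

Definition diagonal_mf (k n : nat) : {set k.-tuple 'I_n} :=
  [set t : k.-tuple 'I_n | sorted ltn [seq val j | j <- t]].

(* Main.v *)
Require Import Defs.
From mathcomp Require Import all_boot all_order all_algebra.
From mathcomp Require Import all_classical all_reals.
From mathcomp Require Import zify.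

Set Implicit Arguments.
Unset Strict Implicit.
Unset Printing Implicit Defensive.

Import Order.TTheory GRing.Theory Num.Theory.

Local Open Scope classical_set_scope.
Local Open Scope ring_scope.

(** Write m = n - k and let all indices start from 0.  Row i of a filter F of
    the k x m grid is an up-set of a chain, hence is determined by its size s_F(i),
    and the sizes weakly increase with i.  So i |-> i + s_F(i) is strictly
    increasing with values below n, and every increasing k-tuple arises from
    exactly one filter in this way: filters and k-subsets correspond
    ([encodes_ex], [encodes_diagonal], [filter_encoded]).

    The characteristic vector of F determines the unit vector at position
    i + s_F(i) of row i by an affine formula: the number of entries at or to
    the right of column c in that row is 1 if c <= i, 0 if c > i + m, and the
    coordinate of the characteristic vector at (i, i + m - c) otherwise.  Taking
    differences of these tails in c gives an affine map [step_map] on all of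
    R^(k x m).  The tails, hence all coordinates of x, are sums of matrix
    entries, so [step_map] is injective.

    An injective affine map commutes with every kind of affine combination and
    preserves extreme points, so it carries affine spans, vertices and hence
    lattices along, and is a unimodular map from any set onto its image
    ([unimodular_map_image]).  What remains is that the image of the order polytope is the matching field
    polytope.  The order polytope is the convex hull of the characteristic
    vectors of filters ([order_polytopeE]), and these are sent to the
    generators of the matching field polytope. *)

(** * Injective affine maps are unimodular onto their image *)

(** Compatibility with combinations of any length is the form in which
    affineness acts on all three kinds of span at once. *)
Definition affine_map (R : realType) (V W : lmodType R) (f : V -> W) : Prop :=
  forall (m : nat) (c : 'I_m -> R) (a : 'I_m -> V), \sum_(i < m) c i = 1 ->
    f (\sum_(i < m) c i *: a i) = \sum_(i < m) c i *: f (a i).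

Lemma combinationsS (R : realType) (V : lmodType R) (C : set R) (A B : set V) :
  A `<=` B -> combinations C A `<=` combinations C B.
Proof.
by move=> AB x [m [c [a [Cc Aa c1 ->]]]]; exists m, c, a; split=> // i; exact/AB.
Qed.

Section AffineMaps.
Context {R : realType} {V W : lmodType R} (f : V -> W).
Hypothesis f_affine : affine_map f.

Lemma affine_map_segment (x y : V) (t : R) :
  f (t *: x + (1 - t) *: y) = t *: f x + (1 - t) *: f y.
Proof.
have := f_affine (c := fun i : 'I_2 => if i == 0 then t else 1 - t)
  (fun i => if i == 0 then x else y).
by rewrite !big_ord_recl !big_ord0 /= !addr0; apply; rewrite addrC subrK.
Qed.

Lemma image_combinations (C : set R) (A : set V) :
  f @` combinations C A = combinations C (f @` A).
Proof.
apply/seteqP; split=> [_ [_ [m [c [a [Cc Aa c1 ->]]]] <-]|].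
  exists m, c, (f \o a); split=> // [i|]; first by exists (a i).
  by rewrite f_affine.
move=> _ [m [c [b [Cc fAb c1 ->]]]].
have /choice[a aP] (i : 'I_m) : exists x, A x /\ f x = b i.
  by case: (fAb i) => x Ax <-; exists x.
exists (\sum_(i < m) c i *: a i).
  by exists m, c, a; split=> // i; case: (aP i).
by rewrite f_affine //; apply: eq_bigr => i _; case: (aP i) => _ ->.
Qed.

Hypothesis f_inj : injective f.

(** Injectivity turns a segment in the image through f x back into a segment
    through x. *)
Lemma image_vertices (P : set V) : f @` vertices P = vertices (f @` P).
Proof.
apply/seteqP; split=> [_ [x [Px xV] <-]|_ [[x Px <-] xV]].
  split; first by exists x.
  move=> _ _ t [y Py <-] [z Pz <-] t01.
  by rewrite -affine_map_segment => /f_inj /(xV _ _ _ Py Pz t01)[-> ->].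
exists x => //; split=> // y z t Py Pz t01 xyz.
have [||| |/f_inj-> /f_inj->//] := xV (f y) (f z) t; last 2 first.
- exact: t01.
- by rewrite xyz affine_map_segment.
- by exists y.
- by exists z.
Qed.

(** The lattice of a set is spanned by its extreme points, and both notions
    are carried along by f. *)
Lemma unimodular_map_image (P : set V) : unimodular_map P (f @` P) f.
Proof.
have f_bij (A : set V) : set_bij A (f @` A) f.
  by apply: inj_bij => x y _ _; apply: f_inj.
split=> //.
- by move=> x y t _ _; exact: affine_map_segment.
- by rewrite /affine_span -image_combinations.
- by rewrite /polytope_lattice /int_affine_span -image_vertices -image_combinations.
Qed.

End AffineMaps.

(** * The order polytope is the hull of its filters *)

Section OrderPolytope.
Context {R : realType} {disp : Order.disp_t} {T : finPOrderType disp}.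

Lemma order_polytope_char_vector (F : {set T}) : is_poset_filter F ->
  order_polytope T R (char_vector R F).
Proof.
move=> Ff; split=> [p q pq|p]; rewrite !ffunE; last by rewrite ler0n lern1 leq_b1.
by rewrite ler_nat; case: (boolP (p \in F)) => // /Ff/(_ pq)->.
Qed.

Lemma order_polytope_convex :
  convex_hull (order_polytope T R) `<=` order_polytope T R.
Proof.
move=> _ [m [c [a [c0 aP c1 ->]]]]; split=> [p q pq|p]; rewrite !sum_ffunE.
  apply: ler_sum => i _; rewrite !ffunE; apply: ler_wpM2l; first exact: c0.
  by case: (aP i) => + _; apply.
have cP i : 0 <= c i := c0 i.
have a01 i : 0 <= (a i p : R) <= 1 by case: (aP i).
apply/andP; split.
  by apply: sumr_ge0 => i _; rewrite ffunE mulr_ge0 //; case/andP: (a01 i).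
rewrite -c1; apply: ler_sum => i _; rewrite ffunE ler_piMr //.
by case/andP: (a01 i).
Qed.

(** A point x is the layer-cake combination of its superlevel sets, which are
    filters because x is monotone: if t_0 = 0 <= ... <= t_N = 1 lists 0, 1 and
    all coordinates of x, then x is the sum of the (t_(l+1) - t_l) times the
    characteristic vector of {p | t_(l+1) <= x p}, and the weights telescope
    to 1. *)
Lemma order_polytopeE : order_polytope T R =
  convex_hull [set char_vector R F | F in [set F | is_poset_filter F]].
Proof.
apply/seteqP; split=> [x [x_mono x01]|]; last first.
  apply: subset_trans order_polytope_convex; apply: combinationsS => _ [F Ff <-].
  exact: order_polytope_char_vector.
(* Repetitions are kept in the list: they only produce zero weights. *)
pose s : seq R := sort <=%R [:: 0, 1 & [seq (x p : R) | p <- enum T]].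
have s_sorted : sorted <=%R s by apply: sort_sorted; exact: le_total.
have s01 y : y \in s -> 0 <= y <= 1.
  rewrite mem_sort !inE => /or3P[/eqP->|/eqP->|/mapP[p _ ->]] //.
    by rewrite lexx ler01.
  by rewrite ler01 lexx.
have s_mem p : (x p : R) \in s.
  by rewrite mem_sort !inE map_f ?orbT // mem_enum.
have szs : size s = (#|T|.+1).+1 by rewrite size_sort /= size_map -cardE.
have s_le i j : (i <= j)%N -> (j < size s)%N -> s`_i <= s`_j.
  move=> ij js; apply: (sorted_leq_nth le_trans (@lexx _ _)) => //.
  by rewrite inE (leq_ltn_trans ij).
have s_first : s`_0 = 0.
  have : 0 \in s by rewrite mem_sort inE eqxx.
  move=> /(nthP 0)[i ilt i0]; apply: le_anti.
  have := s_le 0%N i (leq0n i) ilt; rewrite i0 => -> /=.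
  by have /s01/andP[] : s`_0 \in s by rewrite mem_nth // szs.
have s_last : s`_(#|T|.+1) = 1.
  have : 1 \in s by rewrite mem_sort !inE eqxx orbT.
  move=> /(nthP 0)[i ilt i1]; apply: le_anti.
  have iT : (i <= #|T|.+1)%N by rewrite szs in ilt.
  have := s_le i _ iT; rewrite szs ltnSn i1 => -> //; rewrite andbT.
  by have /s01/andP[] : s`_(#|T|.+1) \in s by rewrite mem_nth // szs.
exists #|T|.+1, (fun i => s`_i.+1 - s`_i),
  (fun i => char_vector R [set p | s`_i.+1 <= (x p : R)]); split.
- by move=> i /=; rewrite subr_ge0 s_le // szs ltnS.
- move=> i; exists [set p | s`_i.+1 <= (x p : R)]%SET => // p q.
  by rewrite !inE => /le_trans + /x_mono; apply.
- by rewrite -(big_mkord xpredT (fun i => s`_i.+1 - s`_i)) telescope_sumr //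
    s_first s_last subr0.
apply/ffunP => p; rewrite sum_ffunE.
(* Truncated at x p, the list telescopes from 0 to x p, and its increments are
   the increments of the list up to x p and vanish beyond. *)
transitivity (\sum_(0 <= i < #|T|.+1)
    (Num.min s`_i.+1 (x p : R) - Num.min s`_i (x p : R))).
  rewrite (telescope_sumr (fun i => Num.min s`_i (x p : R))) // s_first s_last.
  by have /andP[x0 x1] := x01 p; rewrite (min_r x1) (min_l x0) subr0.
rewrite big_mkord; apply: eq_bigr => i _; rewrite !ffunE inE /=.
have [le_x|lt_x] := leP s`_i.+1 (x p : R).
  rewrite (min_l (le_trans _ le_x)) ?s_le //; last by rewrite szs !ltnS -ltnS.
  by rewrite /GRing.scale /= mulr1.
rewrite scaler0 min_r ?subrr //.
(* No breakpoint is skipped: x p is itself in the list, strictly below entry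
   i + 1, hence at most entry i. *)
have /(nthP 0)[l l_lt xl] := s_mem p.
rewrite -xl s_le // ?szs; last by rewrite ltnS ltnW // ltn_ord.
rewrite leqNgt; apply/negP => i_l; move: lt_x.
by rewrite -xl ltNge s_le.
Qed.

End OrderPolytope.

(** * The tuples of the diagonal matching field *)

Section DiagonalField.
Context {R : realType} {k n : nat}.
Implicit Types (t : k.-tuple 'I_n).

Lemma diagonal_mf_inj t u : t \in diagonal_mf k n -> u \in diagonal_mf k n ->
  [set j in t] = [set j in u] -> t = u.
Proof.
rewrite !inE => ts us /setP tu; apply/val_inj/(inj_map val_inj).
apply: (irr_sorted_eq ltn_trans ltnn ts us) => j.
have tuE (i : 'I_n) : (i \in t) = (i \in u) by have := tu i; rewrite !inE.
by apply/mapP/mapP => -[i it ->]; exists i; rewrite // ?tuE // -tuE.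
Qed.

Lemma diagonal_mf_vertex t : t \in diagonal_mf k n ->
  mf_vertex R (diagonal_mf k n) [set j in t] = \sum_(i < k) delta_mx i (tnth t i).
Proof.
move=> tD; rewrite /mf_vertex; case: pickP => [u /andP[uD /eqP uE]|/(_ t)].
  by rewrite (diagonal_mf_inj uD tD uE).
by rewrite tD eqxx.
Qed.

Lemma diagonal_mfP t :
  reflect {homo tnth t : i j / (i < j)%N >-> (i < j)%N} (t \in diagonal_mf k n).
Proof.
rewrite inE; apply: (iffP idP) => [ts i j ij|t_homo].
  have sz (l : 'I_k) : (l < size (map val t))%N by rewrite size_map size_tuple.
  have := sorted_ltn_nth ltn_trans 0%N ts _ _ (sz i) (sz j) ij.
  by rewrite !(nth_map (tnth t i)) ?size_tuple // -!tnth_nth.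
apply/(sortedP 0%N) => i; rewrite size_map size_tuple => ik.
have ik' := ltnW ik.
have x0 := tnth t (Ordinal ik).
rewrite !(nth_map x0) ?size_tuple //.
by rewrite -[i.+1]/(val (Ordinal ik)) -[i in nth _ _ i]/(val (Ordinal ik'))
  -!tnth_nth; apply: t_homo.
Qed.

(** Integrality: strict increase of t makes t_i - i weakly increasing.  The
    inequality is written without truncated subtraction. *)
Lemma diagonal_mf_gap t (i j : 'I_k) : t \in diagonal_mf k n -> (i <= j)%N ->
  (tnth t i + j <= tnth t j + i)%N.
Proof.
move=> /diagonal_mfP t_homo ij.
suff H d (l : 'I_k) : (l = i + d :> nat)%N -> (tnth t i + d <= tnth t l)%N.
  by have := H (j - i)%N j (esym (subnKC ij)); lia.
elim: d l => [|d IHd] l li.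
  by rewrite addn0 (_ : l = i) //; apply: val_inj; rewrite /= li addn0.
have dk : (i + d < k)%N by have := ltn_ord l; lia.
have := IHd (Ordinal dk) erefl.
have : (tnth t (Ordinal dk) < tnth t l)%N by apply: t_homo => /=; lia.
lia.
Qed.

Lemma diagonal_mf_bounds t (i : 'I_k) : t \in diagonal_mf k n ->
  (i <= tnth t i <= i + (n - k))%N.
Proof.
move=> tD; have ik := ltn_ord i.
have k0 : (0 < k)%N by lia.
have kk : (k.-1 < k)%N by lia.
have := @diagonal_mf_gap t (Ordinal k0) i tD isT.
have := @diagonal_mf_gap t i (Ordinal kk) tD; rewrite /=.
have := ltn_ord (tnth t (Ordinal kk)).
lia.
Qed.

Lemma diagonal_mf_card t : t \in diagonal_mf k n -> #|[set j in t]| = k.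
Proof.
rewrite inE => ts; rewrite cardsE -[RHS](size_tuple t); apply/card_uniqP.
exact: map_uniq (sorted_uniq ltn_trans ltnn ts).
Qed.

Lemma diagonal_mf_tuple (J : {set 'I_n}) : #|J| = k ->
  exists2 t, t \in diagonal_mf k n & [set j in t] = J.
Proof.
move=> Jk; have szJ : size (enum J) == k by rewrite -cardE Jk.
exists (Tuple szJ); last by apply/setP => j; rewrite inE mem_enum.
rewrite inE /= sorted_map /enum_mem; apply: sorted_filter.
  by move=> i j l; exact: ltn_trans.
by rewrite -sorted_map -enumT val_enum_ord iota_ltn_sorted.
Qed.

End DiagonalField.

(** * Filters of the grid and increasing tuples *)

Lemma card_ord_geq (m a : nat) : #|[set j : 'I_m | (a <= j)%N]%SET| = (m - a)%N.
Proof.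
rewrite -sum1_card -[RHS]muln1 -sum_nat_const_nat big_geq_mkord.
by apply: eq_bigl => j; rewrite inE.
Qed.

Section FilterTuple.
Context {k n : nat}.
Implicit Types (F : {set grassmann_poset k n}) (t : k.-tuple 'I_n).

Definition encodes t F : Prop :=
  forall i : 'I_k, tnth t i = (i + row_count F i)%N :> nat.

Lemma row_countE F (i : 'I_k) :
  row_count F i = #|[set j : 'I_(n - k) | (i, j) \in F]%SET|.
Proof.
have inj : injective (fun j : 'I_(n - k) => (i, j) : grassmann_poset k n).
  by move=> j j' [].
rewrite /row_count -(card_imset _ inj); congr #|pred_of_set _|.
apply/setP => -[i' j]; rewrite inE; apply/andP/imsetP => /= [[ijF /eqP ii]|].
  by exists j; rewrite ?inE -ii.
by move=> [j']; rewrite inE => jF [-> ->].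
Qed.

Lemma row_count_le F (i : 'I_k) : (row_count F i <= n - k)%N.
Proof. by rewrite row_countE -[leqRHS]card_ord max_card. Qed.

Lemma filter_up F (p q : grassmann_poset k n) : is_poset_filter F ->
  (p <= q)%O -> p \in F -> q \in F.
Proof. by move=> Ff; rewrite le_eqVlt => /orP[/eqP-> //|pq /Ff]; apply. Qed.

(** A row of a filter is an up-set of a chain, so it consists of the last
    elements of that chain and its size decides membership. *)
Lemma mem_filter_row F (i : 'I_k) (j : 'I_(n - k)) : is_poset_filter F ->
  ((i, j) \in F) = (n - k <= j + row_count F i)%N.
Proof.
move=> Ff; rewrite row_countE; apply/idP/idP => [ijF|].
  rewrite -leq_subLR -(card_ord_geq (n - k) j); apply/subset_leq_card/fintype.subsetP => j'.
  by rewrite !inE => jj; apply: filter_up ijF => //; rewrite leEprod /= lexx.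
apply: contraTT => ijF; rewrite -ltnNge.
have : (#|[set j' : 'I_(n - k) | (i, j') \in F]%SET| <= n - k - j.+1)%N.
  rewrite -(card_ord_geq (n - k) j.+1); apply/subset_leq_card/fintype.subsetP => j'.
  rewrite !inE => ij'F; rewrite ltnNge; apply: contra ijF => jj.
  by apply: filter_up ij'F => //; rewrite leEprod /= lexx.
have := ltn_ord j; lia.
Qed.

Lemma row_count_homo F (i i' : 'I_k) : is_poset_filter F ->
  (i <= i')%N -> (row_count F i <= row_count F i')%N.
Proof.
move=> Ff ii; rewrite !row_countE; apply/subset_leq_card/fintype.subsetP => j.
by rewrite !inE; apply: filter_up => //; rewrite leEprod /= lexx andbT.
Qed.

Lemma encodes_diagonal t F : is_poset_filter F -> encodes t F ->
  t \in diagonal_mf k n.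
Proof.
move=> Ff tF; apply/diagonal_mfP => i j ij; rewrite !tF.
by have := row_count_homo Ff (ltnW ij); lia.
Qed.

Lemma encodes_subset t F : encodes t F -> subset_of_filter F = [set j in t].
Proof.
move=> tF; apply/setP => j; rewrite !inE.
apply/existsP/tnthP => -[i ji]; exists i.
  by apply: val_inj; rewrite /= tF; apply/eqP.
by rewrite ji tF.
Qed.

Lemma encodes_ex F : (k <= n)%N -> exists t, encodes t F.
Proof.
move=> kn.
have bound (i : 'I_k) : (i + row_count F i < n)%N.
  by have := row_count_le F i; have := ltn_ord i; lia.
by exists [tuple Ordinal (bound i) | i < k] => i; rewrite tnth_mktuple.
Qed.

(** The filter has t_i - i elements in row i, pushed to the right end.  It is
    upward closed across rows because t_i - i is weakly increasing. *)
Lemma filter_encoded t : t \in diagonal_mf k n ->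
  exists2 F, is_poset_filter F & encodes t F.
Proof.
move=> tD.
exists [set p : grassmann_poset k n | n - k + p.1 <= p.2 + tnth t p.1]%N%SET.
  move=> [i j] [i' j']; rewrite !inE /= => ijF /ltW.
  rewrite leEprod /= => /andP[]; rewrite !leEord => ii jj.
  by have := diagonal_mf_gap tD ii; lia.
move=> i; have := diagonal_mf_bounds i tD => ti; rewrite row_countE.
transitivity (i + #|[set j : 'I_(n - k) | n - k + i - tnth t i <= j]%SET|)%N.
  by rewrite card_ord_geq; lia.
by congr (_ + _)%N; apply: eq_card => j; rewrite !inE /= leq_subLR [(j + _)%N]addnC.
Qed.

End FilterTuple.

(** * The affine map *)

Section StepMap.
Context {R : realType} {k n : nat}.
Local Notation poset := (grassmann_poset k n).
Implicit Types (x : {ffun poset -> R^o}) (t : k.-tuple 'I_n).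

(** For the characteristic vector of a filter F this is 1 if the entry
    i + s_F(i) of row i is at least c, and 0 otherwise.  At most one j
    satisfies the equation c + j = i + (n - k); the sum stands for that
    coordinate of x when it exists, so that affineness in x is immediate. *)
Definition tail x (i : 'I_k) (c : nat) : R :=
  (c <= i)%:R + \sum_(j < n - k | (c + j == i + (n - k))%N) x (i, j).

Definition step_map x : 'M[R]_(k, n) :=
  \matrix_(i, c) (tail x i c - tail x i c.+1).

Lemma tail_coord x i (j : 'I_(n - k)) : tail x i (i + (n - k) - j) = x (i, j).
Proof.
have jm := ltn_ord j.
rewrite /tail (_ : (_ <= i)%N = false); last by lia.
by rewrite add0r (big_pred1 j) // => j'; rewrite /= -val_eqE /=; lia.
Qed.

Lemma tail0 x (i : 'I_k) c : (i + (n - k) < c)%N -> tail x i c = 0.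
Proof.
move=> ic; rewrite /tail (_ : (c <= i)%N = false); last by lia.
by rewrite big_pred0 ?addr0 // => j; lia.
Qed.

Lemma tail1 x (i : 'I_k) c : (c <= i)%N -> tail x i c = 1.
Proof.
move=> ci; rewrite /tail ci big_pred0 ?addr0 // => j.
by have := ltn_ord j; lia.
Qed.

Lemma tail_affine m (c : 'I_m -> R) (a : 'I_m -> {ffun poset -> R^o}) i d :
  \sum_(l < m) c l = 1 ->
  tail (\sum_(l < m) c l *: a l) i d = \sum_(l < m) c l * tail (a l) i d.
Proof.
move=> c1; under [RHS]eq_bigr do rewrite mulrDr.
rewrite big_split /= -mulr_suml c1 mul1r; congr (_ + _).
under [RHS]eq_bigr do rewrite mulr_sumr.
rewrite exchange_big /=; apply: eq_bigr => j _.
by rewrite sum_ffunE; apply: eq_bigr => l _; rewrite ffunE.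
Qed.

Lemma step_map_affine : affine_map step_map.
Proof.
move=> m c a c1; apply/matrixP => i d; rewrite summxE mxE !tail_affine //.
by rewrite -sumrB; apply: eq_bigr => l _; rewrite !mxE mulrBr.
Qed.

(** Summing row i from column i + (n - k) - j on telescopes to a single tail,
    which is the coordinate x (i, j). *)
Lemma step_map_inj : (k <= n)%N -> injective step_map.
Proof.
move=> kn; suff rec x (i : 'I_k) (j : 'I_(n - k)) :
    \sum_(c < n | (i + (n - k) - j <= c)%N) step_map x i c = x (i, j).
  by move=> x y xy; apply/ffunP => -[i j]; rewrite -!rec xy.
have := ltn_ord i; have := ltn_ord j => jm ik.
under eq_bigr do rewrite mxE -opprB.
rewrite -(big_geq_mkord _ _ xpredT (fun c => - (tail x i c.+1 - tail x i c))).
rewrite sumrN telescope_sumr; last by lia.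
by rewrite opprB tail_coord (@tail0 _ _ n) ?subr0 //; lia.
Qed.

Lemma tail_char_vector (F : {set poset}) (i : 'I_k) c : is_poset_filter F ->
  tail (char_vector R F) i c = (c <= i + row_count F i)%N%:R.
Proof.
move=> Ff; have := row_count_le F i => si.
have [ci|ic] := leqP c i; first by rewrite tail1 // (leq_trans ci) ?leq_addr.
have [cm|mc] := leqP c (i + (n - k)); last first.
  by rewrite tail0 // (_ : (c <= _)%N = false) //; lia.
(* Column c now lies in the range where the tail is a coordinate of x. *)
have jm : (i + (n - k) - c < n - k)%N by lia.
rewrite (_ : c = i + (n - k) - Ordinal jm)%N; last by rewrite /=; lia.
by rewrite tail_coord ffunE mem_filter_row //=; congr (nat_of_bool _)%:R; lia.
Qed.

Lemma step_map_char_vector t (F : {set poset}) : is_poset_filter F ->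
  encodes t F -> step_map (char_vector R F) = \sum_(i < k) delta_mx i (tnth t i).
Proof.
move=> Ff tF; apply/matrixP => i c; rewrite mxE !tail_char_vector // summxE.
rewrite (bigD1 i) //= big1 ?addr0 => [|l /negPf li]; last first.
  by rewrite mxE eq_sym li.
rewrite mxE eqxx /= -val_eqE /= tF.
by case: ltngtP => _; rewrite ?subrr ?subr0.
Qed.

Lemma step_map_filter (F : {set poset}) : (k <= n)%N -> is_poset_filter F ->
  step_map (char_vector R F) = mf_vertex R (diagonal_mf k n) (subset_of_filter F).
Proof.
move=> kn Ff; have [t tF] := encodes_ex F kn.
rewrite (step_map_char_vector Ff tF) (encodes_subset tF) diagonal_mf_vertex //.
exact: encodes_diagonal tF.
Qed.

(** Both polytopes are hulls, and the affine map matches their generators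
    through the correspondence of filters and k-subsets. *)
Lemma step_map_order_polytope : (k <= n)%N ->
  step_map @` order_polytope poset R = mf_polytope R (diagonal_mf k n).
Proof.
move=> kn; rewrite order_polytopeE (image_combinations step_map_affine).
congr (convex_hull _).
apply/seteqP; split=> [_ [_ [F Ff <-] <-]|_ [J Jk ->]].
  exists (subset_of_filter F); last exact: step_map_filter.
  have [t tF] := encodes_ex F kn.
  by rewrite (encodes_subset tF) diagonal_mf_card //; exact: encodes_diagonal tF.
have [t tD tJ] := diagonal_mf_tuple Jk; have [F Ff tF] := filter_encoded tD.
exists (char_vector R F); first by exists F.
by rewrite step_map_filter // (encodes_subset tF) tJ.
Qed.

End StepMap.

Theorem theorem2p15 (R : realType) (k n : nat) (hk : (1 <= k)%N)
    (hkn : (k < n)%N) :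
  unimodular_equivalent (order_polytope (grassmann_poset k n) R)
                        (mf_polytope R (diagonal_mf k n)) /\
  exists f : {ffun grassmann_poset k n -> R^o%R} -> 'M[R]_(k, n),
    unimodular_map (order_polytope (grassmann_poset k n) R)
                   (mf_polytope R (diagonal_mf k n)) f /\
    forall F : {set grassmann_poset k n}, is_poset_filter F ->
      f (char_vector R F) = mf_vertex R (diagonal_mf k n) (subset_of_filter F).
Proof.
have kn := ltnW hkn.
have step_uni : unimodular_map (order_polytope (grassmann_poset k n) R)
    (mf_polytope R (diagonal_mf k n)) step_map.
  rewrite -step_map_order_polytope //.
  exact: unimodular_map_image step_map_affine (step_map_inj kn) _.
split; first by exists step_map.
by exists step_map; split=> // F; exact: step_map_filter.
Qed.
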